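(* Let $N$ and $M$ be the two sides of a market with $|N|=|M|=n$ and non-dynamic additive valuations. Assume that $v_i(k)\in\{0,1\}$ for any pair of agents $i,k$, and that every cycle in the desire graph is symmetric. Then the Replacement Algorithm (defined in the context) is EF1-over-time: it is guaranteed to produce a sequence $x^1,x^2,\dots$, each $x^t$ consisting of a single match, such that the cumulative matching $X^t$ is EF1 for every $t\ge0$.
   Context: Setting. $N$ and $M$ are disjoint finite sets of agents with $|N|=|M|=n$. At each time step $t=1,2,\dots$ a single match $x^t=\{i,k\}$ with one agent in $N$ and one in $M$ is chosen irrevocably. The cumulative matching $X^t$ assigns to each agent $i$ the multiset $X_i^t$ of agents matched to $i$ at times $1,\dots,t$ (with multiplicity); $X_i^0=\emptyset$. The same pair may be matched many times. Additive valuations. Each agent $i$ has a value $v_i(k)$ for each agent $k$ on the opposite side, not changing over time (by convention $v_i(k)=0$ if $i,k$ are on the same side), and $v_i(Y)=\sum_{k\in Y}v_i(k)$ for a multiset $Y$ (with multiplicity). Envy and EF1. Envy is considered only within the same side of the market. For $i,j$ on the same side, $i$ envies $j$ under $X$ if $v_i(X_i)<v_i(X_j)$. $X$ is EF1 if whenever $i$ envies $j$ there is $k\in X_j$ such that $v_i(X_i)\ge v_i(X_j\setminus\{k\})$ (one occurrence of $k$ is removed). Desire graph. The undirected graph with vertex set $N\cup M$ and an edge between $i$ and $k$ whenever $v_i(k)+v_k(i)\ge 1$. An edge $\{i,k\}$ is symmetric if $v_i(k)=v_k(i)=1$; a cycle in the desire graph is symmetric if every one of its edges is symmetric. Replacement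 Algorithm. For $t=1,2,\dots$: initialize the tentative match $x^t$ to be any pairing $\{i,k\}$ with $v_i(k)+v_k(i)\ge1$. While there exist agents $i,j$ on the same side with $v_i(X_j^t)-v_i(X_i^t)>1$ (where $X^t$ is $X^{t-1}$ together with the current tentative match $x^t$), choose any such pair and replace $j$ by $i$ in the tentative match, i.e. $x^t\gets (x^t\cup\{i\})\setminus\{j\}$. When no such pair exists, confirm $x^t$ and go to the next time step.
   Formalization: That the algorithm always produces a next match is claimed only when the desire graph has at least one edge, since with all valuations zero (or no agents) it cannot choose an initial pair; every other part of the claim is unconditional. *)

(* Defs.v *)
From mathcomp Require Import all_boot all_order all_algebra.
From mathcomp Require Import finmap multiset.

Set Implicit Arguments.
Unset Strict Implicit.
Unset Printing Implicit Defensive.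

Import Order.TTheory GRing.Theory Num.Theory.
Local Open Scope mset_scope.
Local Open Scope ring_scope.

(* The two sides of the market are the two summands of N + M. *)
Definition same_side (N M : finType) (i j : N + M) : bool := is_inl i == is_inl j.

Section Market.

Context {R : realFieldType} {N M : finType}.

Local Notation agent := (N + M)%type.

Implicit Types (v : agent -> agent -> R) (X : agent -> {mset agent}).
Implicit Types (i j k : agent) (x y : {set agent}) (xs : seq {set agent}).

Definition value v i (Y : {mset agent}) : R := \sum_(k <- Y) v i k.

Definition envies v X i j : Prop := value v i (X i) < value v i (X j).

Definition EF1 v X : Prop :=
  forall i j, same_side i j -> envies v X i j ->
    exists2 k, k \in X j & value v i (X i) >= value v i (X j `\ k).

Definition desire v : rel agent := fun i k => v i k + v k i >= 1.

Definition symmetric_edge v : rel agent :=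
  fun i k => (v i k == 1) && (v k i == 1).

(* A graph cycle is listed by its distinct vertices, at least three of them,
   since [ucycle] also accepts the empty list, loops and edges run back and
   forth. *)
Definition all_cycles_symmetric v : Prop :=
  forall c : seq agent,
    (2 < size c)%N -> ucycle (desire v) c -> cycle (symmetric_edge v) c.

Definition single_match x : Prop :=
  exists (i : N) (k : M), x = [set inl i; inr k].

Definition partners x i : {set agent} :=
  [set k in x | (i \in x) && ~~ same_side i k].

(* If [xs] lists x^1, ..., x^t, then [cumulative xs i] is X_i^t. *)
Definition cumulative xs i : {mset agent} :=
  seq_mset (flatten [seq enum (partners x i) | x <- xs]).

(* In the following, [xs] lists the matches confirmed so far and [x] is the
   tentative match of the current time step. *)

Definition replaceable v xs x i j : Prop :=
  same_side i j /\
  value v i (cumulative (rcons xs x) j) - value v i (cumulative (rcons xs x) i)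
    > 1.

Definition replacement v xs x y : Prop :=
  exists i j, replaceable v xs x i j /\ y = (i |: x) :\ j.

(* The tentative matches that can occur, whatever choices are made. *)
Inductive tentative v xs : {set agent} -> Prop :=
| TentativeInit (i : N) (k : M) :
    v (inl i) (inr k) + v (inr k) (inl i) >= 1 ->
    tentative v xs [set inl i; inr k]
| TentativeReplace x y :
    tentative v xs x -> replacement v xs x y -> tentative v xs y.

Definition confirmed v xs x : Prop :=
  tentative v xs x /\ ~ exists i j, replaceable v xs x i j.

(* The sequences x^1, ..., x^t that the first t time steps of some execution
   can confirm. *)
Inductive produced v : seq {set agent} -> Prop :=
| ProducedNil : produced v [::]
| ProducedRcons xs x :
    produced v xs -> confirmed v xs x -> produced v (rcons xs x).

End Market.

(* Main.v *)
(** Let [d a] count the past matches of [a] along symmetric edges. Give the end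
    [a] of an edge [{a, b}] the weight [d a] if the edge is symmetric, and the
    multiplicity of the match [{a, b}] otherwise. A replacement of [{j, k}] by
    [{i, k}] means [v_i(k) = 1] and [v_i(X_i) < v_i(X_j)] for the bundles
    confirmed so far; as two distinct common neighbours of [i] and [j] would close a symmetric
    4-cycle, this gives
      [weight i k <= v_i(X_i) < v_i(X_j) <= weight j k].
    To turn this local decrease into a global one, add to the weight of [a] a
    potential [g b] of the other end, chosen so that the sum does not depend on
    which end is called [a]: this prescribes [g a - g b = d a - d b] on
    symmetric edges and [g a = g b] on the others. Such a [g] exists because nonsymmetric
    edges are bridges. Hence the while loop terminates, and its exit condition
    is EF1 for binary valuations. *)

Require Import Defs.
From mathcomp Require Import all_boot all_order all_algebra.
From mathcomp Require Import finmap multiset.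
From mathcomp Require Import lra.

Set Implicit Arguments.
Unset Strict Implicit.
Unset Printing Implicit Defensive.

Import Order.TTheory GRing.Theory Num.Theory.
Local Open Scope ring_scope.

(* Edges outside [S] are bridges of [G], so [c] can be built by adding them one
   at a time, each time shifting [c] on one of the two components joined. *)
Lemma bridge_potential (T : finType) (V : zmodType) (G S : rel T)
    (w : T -> T -> V) :
  irreflexive G -> symmetric G -> symmetric S -> subrel S G ->
  (forall p, (2 < size p)%N -> ucycle G p -> cycle S p) ->
  (forall x y, w y x = - w x y) ->
  exists c : T -> V, (forall x y, S x y -> c x = c y) /\
    (forall x y, G x y -> ~~ S x y -> c x - c y = w x y).
Proof.
move=> irrG symG symS subSG cycS wN.
suff [c cS cw] : exists2 c : T -> V, (forall x y, S x y -> c x = c y) &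
    forall p, p \in [seq p <- enum {: T * T} | G p.1 p.2 && ~~ S p.1 p.2] ->
      c p.1 - c p.2 = w p.1 p.2.
  exists c; split=> // x y Gxy nSxy.
  by apply: (cw (x, y)); rewrite mem_filter Gxy nSxy mem_enum.
have: all [pred p | G p.1 p.2 && ~~ S p.1 p.2]
  [seq p <- enum {: T * T} | G p.1 p.2 && ~~ S p.1 p.2] by exact: filter_all.
elim: [seq _ <- _ | _] => [_|[a b] s IHs]; first by exists (fun=> 0).
rewrite [all _ _]/= => /andP[/andP[/= Gab nSab] Gs].
have [c cS cw] := IHs Gs.
(* [H] is the graph built so far: all of [S] and the listed edges, in both directions. *)
pose H := [rel x y | [|| S x y, (x, y) \in s | (y, x) \in s]].
have symH : symmetric H by move=> x y /=; rewrite symS [(_ \in s) || _]orbC.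
have subHG : subrel H G.
  move=> x y /or3P[/subSG //|/(allP Gs)/andP[] //|/(allP Gs)/andP[]].
  by rewrite /= symG.
case: (boolP (connect H a b)) => [/connectP[p0 Hp eb]|nHab].
  (* If [a] and [b] are already connected, [{a, b}] is already in [H], possibly listed as [(b, a)]:
     otherwise a simple [H]-path closed by it would be a [G]-cycle, which puts [{a, b}] in [S]. *)
  have [Hab|nHab] := boolP (H a b).
    exists c => // p; rewrite inE => /predU1P[->|]; last exact: cw.
    case/or3P: Hab => [|/cw //|/cw /= e]; first by rewrite (negPf nSab).
    by rewrite (wN b a) -e opprB.
  case/shortenP: Hp eb => p Hp up _ eb.
  suff: S a b by rewrite (negPf nSab).
  have: cycle S (a :: p).
    apply: cycS.
      case: p Hp eb {up} => [_ eb|x [/andP[Hax _] eb|//]].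
        by rewrite /= in eb; rewrite eb irrG in Gab.
      by case/negP: nHab; rewrite eb.
    apply/andP; split=> //.
    rewrite /cycle rcons_path (sub_path subHG Hp) /= -eb.
    by rewrite symG.
  by rewrite /cycle rcons_path -eb => /andP[_]; rewrite symS.
(* The shift makes the new equation hold. Each edge of [H] lies in one component, so the earlier
   equations survive. *)
exists (fun x => c x + (if connect H a x then w a b - (c a - c b) else 0)).
  move=> x y Sxy; rewrite (cS _ _ Sxy).
  have Hxy : connect H x y by apply: connect1; rewrite /= Sxy.
  by rewrite (same_connect_r (sym_connect_sym symH) Hxy).
move=> [x y]; rewrite inE => /predU1P[[-> ->]|sxy] /=.
  by rewrite connect0 (negPf nHab) addr0 addrAC addrC subrK.
have Hxy : connect H x y by apply: connect1; rewrite /= sxy orbT.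
rewrite (same_connect_r (sym_connect_sym symH) Hxy).
by rewrite [- (c y + _)]opprD addrACA subrr addr0; apply: (cw (x, y)).
Qed.

(** * Bundle values as multiplicity sums, and edge weights *)

Section Matchings.

Context {R : realFieldType} {N M : finType}.

Local Notation agent := (N + M)%type.

Implicit Types (v : agent -> agent -> R) (i j k a b : agent).
Implicit Types (x : {set agent}) (xs : seq {set agent}).

Definition mult xs j k : nat := count (fun x => k \in partners x j) xs.

Lemma same_side_refl i : same_side i i.
Proof. exact: eqxx. Qed.

Lemma same_side_sym i j : same_side i j = same_side j i.
Proof. exact: eq_sym. Qed.

Lemma same_side_congr i j k : same_side i j -> same_side i k = same_side j k.
Proof. by rewrite /same_side => /eqP ->. Qed.

Lemma same_side_neq i k : ~~ same_side i k -> i != k.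
Proof. by apply: contraNneq => ->; exact: same_side_refl. Qed.

Lemma mult_sym xs j k : mult xs j k = mult xs k j.
Proof.
by apply: eq_count => x; rewrite !inE same_side_sym andbCA.
Qed.

Lemma value_cumulative v xs i j :
  value v i (cumulative xs j) = \sum_k v i k *+ mult xs j k.
Proof.
rewrite /value (perm_big _ (perm_eq_seq_mset _)) /= big_flatten big_map.
under eq_bigr do rewrite big_enum big_mkcond /=.
rewrite exchange_big /=; apply: eq_bigr => k _.
by rewrite -big_mkcond /= big_const_seq iter_addr_0.
Qed.

Lemma value_cumulative_rcons v xs x i j :
  value v i (cumulative (rcons xs x) j) =
  value v i (cumulative xs j) + \sum_(k in partners x j) v i k.
Proof.
rewrite !value_cumulative [X in _ + X]big_mkcond -big_split /=.
apply: eq_bigr => k _.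
by rewrite /mult -cats1 count_cat /= addn0 mulrnDr; case: (k \in _).
Qed.

Lemma partners_pair a b : ~~ same_side a b -> partners [set a; b] a = [set b].
Proof.
move=> ab; apply/setP => k; rewrite !inE eqxx /=.
have [-> /=|_] := eqVneq k a; last by case: eqVneq => // ->.
by rewrite same_side_refl (negPf (same_side_neq ab)).
Qed.

Lemma single_match_pair a b : ~~ same_side a b -> single_match [set a; b].
Proof.
case: a b => [a|a] [b|b] //= _; first by exists a, b.
by exists b, a; rewrite setUC.
Qed.

Lemma pair_inj a b c d : [set a; b] = [set c; d] :> {set agent} -> c != d ->
  (a, b) = (c, d) \/ (a, b) = (d, c).
Proof.
move=> e cd.
have: c \in [set a; b] by rewrite e !inE eqxx.
have: d \in [set a; b] by rewrite e !inE eqxx orbT.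
rewrite !inE => /orP[]/eqP hd /orP[]/eqP hc; move: cd; rewrite hc hd ?eqxx //.
  by right.
by left.
Qed.

Lemma replace_pair i j k : ~~ same_side j k -> ~~ same_side i k -> i != j ->
  (i |: [set j; k]) :\ j = [set i; k].
Proof.
move=> jk ik ij; apply/setP => l; rewrite !inE.
have [->|//] := eqVneq l j.
by rewrite [j == i]eq_sym (negPf ij) (negPf (same_side_neq jk)).
Qed.

Definition weight v xs a b : R :=
  if symmetric_edge v a b
  then \sum_(l | symmetric_edge v a l) (mult xs a l)%:R
  else (mult xs a b)%:R.

Lemma symmetric_edge_sym v : symmetric (symmetric_edge v).
Proof. by move=> a b; rewrite /symmetric_edge andbC. Qed.

Lemma desire_sym v : symmetric (desire v).
Proof. by move=> a b; rewrite /desire addrC. Qed.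

Lemma symmetric_edge_desire v : subrel (symmetric_edge v) (desire v).
Proof. by move=> a b /andP[/eqP va /eqP vb]; rewrite /desire va vb; lra. Qed.

End Matchings.

(** * One time step under binary valuations and symmetric cycles *)

Section Step.

Context {R : realFieldType} {N M : finType}.

Local Notation agent := (N + M)%type.

Context (v : agent -> agent -> R).
Hypothesis v_same_side : forall i k, same_side i k -> v i k = 0.
Hypothesis v01 : forall i k, v i k = 0 \/ v i k = 1.
Hypothesis cycles_sym : all_cycles_symmetric v.

Implicit Types (i j k a b : agent) (x : {set agent}) (xs : seq {set agent}).

Lemma binary_ge0 i k : 0 <= v i k.
Proof. by case: (v01 i k) => ->; lra. Qed.

Lemma desire_opposite a b : desire v a b -> ~~ same_side a b.
Proof.
apply: contraTN => ab.
by rewrite /desire !v_same_side // 1?same_side_sym // -ltNge; lra.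
Qed.

Lemma desire_of_value1 i k : v i k = 1 -> desire v i k.
Proof. by rewrite /desire => ->; have := binary_ge0 k i; lra. Qed.

Lemma common_neighbour i j k l :
  v i k = 1 -> v i l = 1 -> desire v j k -> desire v j l -> i != j -> k != l ->
  symmetric_edge v j k && symmetric_edge v j l.
Proof.
move=> vik vil jk jl ij kl.
have neq a b : desire v a b -> a != b by move=> /desire_opposite/same_side_neq.
have ucyc : ucycle (desire v) [:: i; k; j; l].
  rewrite /ucycle /= !inE !negb_or !andbT ij kl.
  have [ik il] := (desire_of_value1 vik, desire_of_value1 vil).
  have [kj li] : desire v k j /\ desire v l i.
    by rewrite (desire_sym v k) (desire_sym v l).
  by rewrite ik kj jl li (neq i k) ?(neq i l) ?(neq k j) ?(neq j l).
have /and4P[_ kj sjl _] := cycles_sym (c := [:: i; k; j; l]) isT ucyc.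
by rewrite symmetric_edge_sym kj.
Qed.

Definition desire_matches xs : Prop :=
  forall x, x \in xs -> exists a b, desire v a b /\ x = [set a; b].

Definition balanced xs : Prop := forall i j, same_side i j ->
  value v i (cumulative xs j) - value v i (cumulative xs i) <= 1.

Lemma mult_gt0_desire xs a b :
  desire_matches xs -> (0 < mult xs a b)%N -> desire v a b.
Proof.
move=> dxs; rewrite -has_count => /hasP[x /dxs[c [d [cd ->]]]].
rewrite !inE => /and3P[] /orP[] /eqP-> /orP[] /eqP->;
  rewrite ?same_side_refl //.
by rewrite desire_sym.
Qed.

(** In both cases the weight counts only matches of [i] with agents that [i] values at 1. *)
Lemma weight_le_value xs i k :
  v i k = 1 -> weight v xs i k <= value v i (cumulative xs i).
Proof.
move=> vik; rewrite value_cumulative /weight; case: ifP => _.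
  rewrite big_mkcond; apply: ler_sum => l _.
  case: ifP => [/andP[/eqP-> _]|_] //.
  by rewrite mulrn_wge0 ?binary_ge0.
rewrite (bigD1 k) //= vik lerDl.
by apply: sumr_ge0 => l _; rewrite mulrn_wge0 ?binary_ge0.
Qed.

(** A match of [j] with some [l != k] that [i] values makes [k] and [l] common neighbours of [i] and
    [j]. So such an [l] contributes only when [{j, k}] and [{j, l}] are both symmetric, and then the
    weight counts it too. *)
Lemma value_le_weight xs i j k :
  desire_matches xs -> v i k = 1 -> desire v j k -> i != j ->
  value v i (cumulative xs j) <= weight v xs j k.
Proof.
move=> dxs vik jk ij; rewrite value_cumulative /weight.
have common l : l != k -> v i l *+ mult xs j l != 0 ->
    symmetric_edge v j k && symmetric_edge v j l.
  rewrite mulrn_eq0 negb_or -lt0n => lk /andP[jl vil].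
  apply: (@common_neighbour i) => //; last by rewrite eq_sym.
    by case: (v01 i l) vil => // ->; rewrite eqxx.
  exact: mult_gt0_desire jl.
case: ifP => [sjk|nsjk].
  rewrite [leRHS]big_mkcond; apply: ler_sum => l _.
  have [->|lk] := eqVneq l k; first by rewrite sjk vik.
  have [->|/(common _ lk)/andP[_ ->]] := eqVneq (v i l *+ mult xs j l) 0.
    by case: ifP.
  by case: (v01 i l) => ->; rewrite ?mul0rn.
rewrite (bigD1 k) //= vik gerDl big1 // => l lk.
by apply/eqP/negPn/negP => /(common _ lk); rewrite nsjk.
Qed.

(** The gap is at most 1 before the tentative match and exceeds 1 after it. Hence the match raises
    it by exactly 1, and it was positive before. *)
Lemma replaceableP xs a b i j :
  balanced xs -> desire v a b -> replaceable v xs [set a; b] i j ->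
  exists k, [/\ [set a; b] = [set j; k], desire v j k, ~~ same_side i k, i != j
    & v i k = 1 /\ value v i (cumulative xs i) < value v i (cumulative xs j)].
Proof.
move=> bal ab [sij]; rewrite !value_cumulative_rcons => gt1.
have nab := desire_opposite ab.
have ij : i != j by apply: contraTneq gt1 => ->; rewrite subrr -leNgt; lra.
have balij := bal _ _ sij.
have absent l x : l \notin x -> partners x l = set0.
  by move=> lx; apply/setP => k; rewrite [in LHS]inE (negPf lx) andbF inE.
(* A match without [j] cannot widen the gap. *)
have jab : j \in [set a; b].
  apply: contraLR gt1 => /absent ->; rewrite big_set0 addr0 -leNgt.
  have : 0 <= \sum_(k in partners [set a; b] i) v i k.
    by apply: sumr_ge0 => k _; apply: binary_ge0.
  lra.
have [k ek jk] : exists2 k, [set a; b] = [set j; k] & desire v j k.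
  move: jab; rewrite !inE => /orP[]/eqP->; first by exists b.
  by exists a; [rewrite setUC | rewrite desire_sym].
have njk := desire_opposite jk.
have nik : ~~ same_side i k by rewrite (same_side_congr k sij).
exists k; split=> //; move: gt1; rewrite ek partners_pair // big_set1 absent.
  by rewrite big_set0; case: (v01 i k) => ->; [lra | split=> //; lra].
by rewrite !inE (negPf ij) same_side_neq.
Qed.

(** The incoming agent values the partner it takes over at 1, so replacements stay within the desire
    graph. *)
Lemma tentative_desire xs x : balanced xs -> tentative v xs x ->
  exists a b, desire v a b /\ x = [set a; b].
Proof.
move=> bal; elim=> {x} [i k ik|_ y _ [a [b [ab ->]]] [i [j [rij ->]]]].
  by exists (inl i), (inr k).
have [k [-> jk ik ij [vik _]]] := replaceableP bal ab rij.
exists i, k; split; first exact: desire_of_value1.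
by rewrite replace_pair // desire_opposite.
Qed.

Lemma produced_invariant xs : produced v xs -> desire_matches xs /\ balanced xs.
Proof.
elim=> [|{}xs x _ [dxs bal] [tx nrx]].
  split=> // i j _; rewrite !value_cumulative !big1 ?subrr //; exact: ler01.
split=> [y|i j sij].
  by rewrite mem_rcons inE => /predU1P[->|/dxs //]; exact: tentative_desire tx.
by rewrite leNgt; apply/negP => gt1; apply: nrx; exists i, j.
Qed.

Lemma replacement_potential xs : desire_matches xs -> balanced xs ->
  exists Phi : agent -> agent -> R,
    (forall a b, desire v a b -> Phi a b = Phi b a) /\
    (forall i j k, desire v j k -> v i k = 1 -> i != j ->
      value v i (cumulative xs i) < value v i (cumulative xs j) ->
      Phi i k < Phi j k).
Proof.
move=> dxs bal.
pose d a : R := \sum_(l | symmetric_edge v a l) (mult xs a l)%:R.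
have irr : irreflexive (desire v).
  by move=> a; apply/negP => /desire_opposite; rewrite same_side_refl.
have [c [cS cB]] := bridge_potential (w := fun a b => d b - d a) irr
  (@desire_sym _ _ _ v) (@symmetric_edge_sym _ _ _ v)
  (@symmetric_edge_desire _ _ _ v) cycles_sym (fun a b => esym (opprB _ _)).
(* [d + c] is the potential of the other end: along symmetric edges [c] is constant, and along the
   others its change cancels that of [d]. *)
exists (fun a b => weight v xs a b + (d b + c b)).
split=> [a b ab|i j k jk vik ij lt].
  rewrite /weight (symmetric_edge_sym v b); case: ifPn => [sab|nsab].
    by rewrite -/(d a) -/(d b) (cS _ _ sab); lra.
  by have := cB _ _ ab nsab; rewrite mult_sym; lra.
rewrite ltrD2r; apply: le_lt_trans (weight_le_value _ vik) _.
exact: lt_le_trans lt (value_le_weight dxs vik jk ij).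
Qed.

Lemma replacement_Acc xs a b : desire_matches xs -> balanced xs ->
  desire v a b -> Acc (fun z y => replacement v xs y z) [set a; b].
Proof.
move=> dxs bal; have [Phi [symPhi decPhi]] := replacement_potential dxs bal.
(* The order on [R] is not well-founded, so the induction is on the number of pairs of smaller
   potential. *)
pose below a b : {set agent * agent} := [set q | Phi q.1 q.2 < Phi a b].
have [m] := ubnP #|below a b|; elim: m a b => [//|m IHm a b lem ab].
constructor=> _ [i [j [rij ->]]].
have [k [ek jk ik ij [vik lt]]] := replaceableP bal ab rij.
rewrite ek (replace_pair (desire_opposite jk) ik ij).
apply: (IHm i k); last exact: desire_of_value1.
(* The set does not tell which end is replaced; the symmetry of [Phi] on desire edges makes this
   harmless. *)
have Phi_ab : Phi a b = Phi j k.
  have [[-> ->] //|[-> ->]] := pair_inj ek (same_side_neq (desire_opposite jk)).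
  by rewrite symPhi // desire_sym.
have ltPhi : Phi i k < Phi a b by rewrite Phi_ab; apply: decPhi.
rewrite -ltnS; apply: leq_trans lem; rewrite ltnS; apply: proper_card.
apply/properP; split; last by exists (i, k); rewrite inE /= ?ltxx.
by apply/subsetP => q; rewrite !inE => /lt_trans; apply.
Qed.

Lemma confirmed_exists xs x :
  tentative v xs x -> Acc (fun z y => replacement v xs y z) x ->
  exists y, confirmed v xs y.
Proof.
move=> + acx; elim: acx => {}x _ IHx tx.
(* A boolean form of [replaceable], so that the exit test can be decided. *)
pose r i j := same_side i j && (value v i (cumulative (rcons xs x) j) -
  value v i (cumulative (rcons xs x) i) > 1).
have [/existsP[i /existsP[j /andP[sij gt1]]]|/existsPn nr] :=
    boolP [exists i, exists j, r i j].
  have rx : replacement v xs x ((i |: x) :\ j) by exists i, j.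
  exact: IHx rx (TentativeReplace tx rx).
exists x; split=> // -[i [j [sij gt1]]].
by have /existsPn/(_ j) := nr i; rewrite /r sij gt1.
Qed.

(** An envied bundle has positive value, hence contains an agent worth 1; removing it closes a gap
    of at most 1. *)
Lemma balanced_EF1 xs : balanced xs -> EF1 v (cumulative xs).
Proof.
move=> bal i j sij ltij; have {bal} := bal _ _ sij.
move: ltij; rewrite /envies; set Y := cumulative xs j => ltij le1.
have [k kY vik] : exists2 k, k \in Y & v i k = 1.
  have [/hasP[k kY /eqP vik]|/hasPn no] := boolP (has (fun k => v i k == 1) Y).
    by exists k.
  have vY0 : value v i Y = 0.
    rewrite /value big_seq big1 // => k /no; case: (v01 i k) => // ->.
    by rewrite eqxx.
  suff : 0 <= value v i (cumulative xs i) by rewrite leNgt -vY0 ltij.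
  by apply: sumr_ge0 => l _; apply: binary_ge0.
exists k => //.
have : value v i Y = v i k + value v i (Y `\ k)%mset.
  rewrite {1}/value -{1}(msetB1K kY) -{1}[(Y `\ k)%mset]seq_mset_id -mset_cons.
  by rewrite (perm_big _ (perm_eq_seq_mset _)) big_cons.
rewrite vik; lra.
Qed.

End Step.

Theorem theorem5p1 (R : realFieldType) (N M : finType) (n : nat)
    (cardN : #|N| = n) (cardM : #|M| = n)
    (v : N + M -> N + M -> R)
    (v_same_side : forall i k, same_side i k -> v i k = 0)
    (v01 : forall i k, v i k = 0 \/ v i k = 1)
    (cycles_sym : all_cycles_symmetric v) :
  forall xs : seq {set N + M}, produced v xs ->
    [/\ (forall x, x \in xs -> single_match x),
        EF1 v (cumulative xs),
        (* every tentative match is a pair, and the while loop terminates *)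
        (forall x, tentative v xs x ->
           single_match x /\ Acc (fun z y => replacement v xs y z) x)
      & (* some next match is confirmed, provided some pair is admissible *)
        (exists i k, desire v i k) -> exists x, confirmed v xs x].
Proof.
move=> xs pxs; have [dxs bal] := produced_invariant v_same_side v01 pxs.
have tent x : tentative v xs x ->
    single_match x /\ Acc (fun z y => replacement v xs y z) x.
  move=> /(tentative_desire v_same_side v01 bal)[a [b [ab ->]]].
  split; first exact: single_match_pair (desire_opposite v_same_side ab).
  exact: replacement_Acc.
split=> //.
- move=> x /dxs[a [b [ab ->]]].
  exact: single_match_pair (desire_opposite v_same_side ab).
- exact: balanced_EF1.
case=> a [b ab].
have [i [k ik]] : exists (i : N) (k : M), desire v (inl i) (inr k).
  have := desire_opposite v_same_side ab.
  case: a b ab => [a|a] [b|b] //= ab _; first by exists a, b.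
  by exists b, a; rewrite desire_sym.
have tik := TentativeInit xs ik.
by have [_ /(confirmed_exists tik)] := tent _ tik.
Qed.
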